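(* Let $N\geq 2$ and let $p,q>N$ be integers with $\gcd(N,p)=\gcd(N,q)=1$. Put $d=\gcd(p,q)$, $\tilde p=p/d$, $\tilde q=q/d$. Let $B$ be the minimal braid associated with $(N,p,q)$ and $w(B)$ its writhe number. 1) If $\tilde p$ and $\tilde q$ have different parities, then $w(B)=0$. 2) If $\tilde p$ and $\tilde q$ have the same parity, then up to sign $$w(B)=d\sum_{s=1}^{N-1}(-1)^{\left[\frac{ps}{N}\right]}(-1)^{\left[\frac{qs}{N}\right]},$$ i.e. $w(B)$ equals the right-hand side or its opposite, where $[\ ]$ denotes the integral part (floor).
   Context: Minimal braid: let $\eta>0$ be a very small irrational number and let $\varepsilon\in\mathbb{R}$ (the phase; the basic choice is $\varepsilon=0$). For $k=0,\dots,N-1$ let $$B_k:[\eta,1+\eta]\to\mathbb{R}^2,\quad B_k(t)=(x_k(t),y_k(t))=\Bigl(\sin\bigl(\tfrac{2\pi}{N}q(t+k)\bigr),\ \cos\bigl(\tfrac{2\pi}{N}p(t+k+\varepsilon)\bigr)\Bigr).$$ The phase $\varepsilon$ is assumed to be such that $B_0(t),\dots,B_{N-1}(t)$ are pairwise distinct for every $t$. The $B_k$ are the strands of a closed $N$-braid $B$ in $\mathbb{S}^1\times\mathbb{R}^2$. A crossing point of $B$ is a triple $(k,l,t)$ with $0\leq k<l\leq N-1$ and $t\in[\eta,1+\eta]$ such that $x_k(t)=x_l(t)$. Its sign $S\in\{-1,+1\}$ is the usual sign of a braid crossing, namely the sign of $(x_k'(t)-x_l'(t))(y_k(t)-y_l(t))$;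 with this convention all crossing points are positive in the torus knot case $p=q$, $\varepsilon=0$. The writhe number $w(B)$ is the sum of the signs of all crossing points of $B$. *)

(* Defs.v *)
From mathcomp Require Import all_boot all_order all_algebra.
From mathcomp Require Import all_classical all_reals all_analysis.

Set Implicit Arguments.
Unset Strict Implicit.
Unset Printing Implicit Defensive.

Import Order.TTheory GRing.Theory Num.Theory.
Import numFieldNormedType.Exports.

Local Open Scope classical_set_scope.
Local Open Scope ring_scope.

Section MinimalBraid.
Context {R : realType}.
Variables (N p q : nat) (eps eta : R).

Definition strand_x (k : nat) (t : R) : R :=
  sin (2 * pi / N%:R * (q%:R * (t + k%:R))).

Definition strand_y (k : nat) (t : R) : R :=
  cos (2 * pi / N%:R * (p%:R * (t + k%:R + eps))).

(* The formula makes sense for every real t; the interval of definition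
   [eta, 1 + eta] is imposed in [distinct_strands] and [crossing_points]. *)
Definition strand (k : nat) (t : R) : R * R := (strand_x k t, strand_y k t).

Definition distinct_strands : Prop :=
  forall t : R, eta <= t <= 1 + eta ->
  forall k l : 'I_N, k != l -> strand k t != strand l t.

Definition crossing_points : set ('I_N * 'I_N * R) :=
  [set c : 'I_N * 'I_N * R | let: (k, l, t) := c in
     [/\ (k < l)%N, eta <= t <= 1 + eta & strand_x k t = strand_x l t]].

(* The derivatives are two-sided derivatives of the extensions to R; an
   irrational eta makes eta and 1 + eta crossing-free when coprime N q. *)
Definition crossing_sign (c : 'I_N * 'I_N * R) : int :=
  let: (k, l, t) := c in
  sgz ((derive1 (strand_x k) t - derive1 (strand_x l) t)
       * (strand_y k t - strand_y l t)).

(* A finitely supported sum: [crossing_points] is finite when 0 < N and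
   coprime N q, so the default value 0 on infinite supports plays no role. *)
Definition writhe : int := \sum_(c \in crossing_points) crossing_sign c.

End MinimalBraid.

(* Main.v *)
(** Strands k < l meet exactly at the times t = N (2m+1) / (4q) - (k+l)/2, and
    product-to-sum formulas factor the sign of this crossing as a function of
    s = l - k times a function w of m.  Summing over k with s fixed, the ranges
    of m telescope; the symmetry s -> N - s shifts m by q and identifies the
    leftover ranges, so the writhe is the product of
    sum_{0<s<N} (-1)^[ps/N] (-1)^[qs/N] and of sum_{0<=m<q} w(m).
    Shifting m by q' multiplies w by (-1)^(p'+q').  If p' and q' are odd, the
    substitution 2m+1 -> p'(2m+1) reduces the second sum to d times the sum of
    (-1)^j sgn sin(delta + pi (2j+1) / (2q')) over a period in j; over the
    period on which the sine is positive this is an alternating sum of an odd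
    number of signs, that is, 1 or -1. *)
Require Import Defs.
From mathcomp Require Import all_boot all_order all_algebra.
From mathcomp Require Import all_classical all_reals all_analysis.
From mathcomp Require Import zify ring lra.

Set Implicit Arguments.
Unset Strict Implicit.
Unset Printing Implicit Defensive.

Import Order.TTheory GRing.Theory Num.Theory.
Local Open Scope ring_scope.

(** * Rearrangement of finite sums: triangles, quasi-periods, telescoping *)

Lemma sum_triangle (V : nmodType) (N : nat) (G : nat -> nat -> V) :
  \sum_(k < N) \sum_(l < N | (k < l)%N) G k l =
  \sum_(1 <= s < N) \sum_(0 <= k < N - s) G k (k + s)%N.
Proof.
rewrite -(big_mkord xpredT (fun k => \sum_(l < N | (k < l)%N) G k l)).
transitivity (\sum_(0 <= k < N) \sum_(1 <= s < N | (s < N - k)%N) G k (k + s)%N).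
  apply: eq_big_nat => k /andP[_ ltkN].
  rewrite -(big_mkord (fun l => k < l)%N (G k)) (@big_cat_nat _ _ _ k.+1)//=.
  rewrite big_nat_cond big_pred0 ?add0r; last by move=> i; lia.
  rewrite big_nat_cond (eq_bigl (fun l => k < l < N)%N); last by move=> i; lia.
  rewrite -big_nat -add1n big_addn -(big_nat_widen _ _ _ xpredT) ?leq_subr//.
  by apply: eq_bigr => i _; rewrite addnC.
rewrite (exchange_big_dep xpredT)//=; apply: eq_big_nat => s /andP[s1 sN].
rewrite [RHS](big_nat_widen _ _ N) ?leq_subr//.
by rewrite big_nat_cond [RHS]big_nat_cond; apply: eq_bigl => k; lia.
Qed.

Lemma sum_quasi_periodic (S : pzRingType) (e : S) (f : nat -> S) (n d : nat) :
  (forall m, f (m + n)%N = e * f m) ->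
  \sum_(0 <= m < d * n) f m = (\sum_(0 <= i < d) e ^+ i) * \sum_(0 <= m < n) f m.
Proof.
move=> fn; elim: d => [|d IHd]; first by rewrite mul0n !(@big_geq _ _ _ 0 0)// mul0r.
rewrite mulSn addnC (@big_cat_nat _ _ _ (d * n))//= ?leq_addr// IHd.
rewrite big_nat_recr//= mulrDl; congr (_ + _).
rewrite -{1}[(d * n)%N]add0n big_addn addKn mulr_sumr.
apply: eq_big_nat => m _; elim: (d) => [|c IHc]; first by rewrite mul1r addn0.
by rewrite mulSn addnCA addnC fn IHc exprS mulrA.
Qed.

Lemma sum_window (S : nmodType) (f : nat -> S) (n a : nat) :
  (forall m, f (m + n)%N = f m) ->
  \sum_(0 <= i < n) f (a + i)%N = \sum_(0 <= i < n) f i.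
Proof.
move=> fn; elim: a => [|a IHa]; first by [].
rewrite -IHa; case: n fn {IHa} => [|n] fn; first by rewrite !big_geq.
rewrite [RHS]big_nat_recl// big_nat_recr//= addrC addSnnS fn addn0.
by congr (_ + _); apply: eq_big_nat => i _; rewrite addSnnS.
Qed.

(** For fixed [a = l - k] the index [k + l = 2k + a] advances by 2, so consecutive ranges abut and
    leave only the range from [E a] to [E (2N - a)]. The quasi-periods of [E] and [t] split off one
    full sum over [q]; what remains cancels under [a -> N - a]. *)
Lemma sum_telescope_arcs (S : comPzRingType) (N q : nat) (e : S)
  (s t : nat -> S) (E : nat -> nat) :
  {homo E : a b / (a <= b)%N} -> (forall j, E (j + N)%N = E j + q)%N ->
  (forall m, t (m + q)%N = e * t m) ->
  (forall a, (0 < a < N)%N -> s a = e * s (N - a)%N) ->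
  \sum_(k < N) \sum_(l < N | (k < l)%N)
      s (l - k)%N * \sum_(E (k + l)%N <= m < E (k + l).+2%N) t m =
  (\sum_(1 <= a < N) s a) * \sum_(0 <= m < q) t m.
Proof.
move=> homoE EN tq sN; pose F a := \sum_(0 <= m < E a) t m.
have FB a b : (a <= b)%N -> \sum_(E a <= m < E b) t m = F b - F a.
  move=> ab; rewrite /F (@big_cat_nat _ _ _ (E a) 0 (E b))//= ?homoE//.
  by rewrite addrAC subrr add0r.
have FN a : F (a + N)%N = \sum_(0 <= m < q) t m + e * F a.
  rewrite /F EN addnC (@big_cat_nat _ _ _ q)//= ?leq_addr//; congr (_ + _).
  rewrite -{1}[q]add0n big_addn addKn mulr_sumr.
  by apply: eq_bigr => m _; rewrite tq.
rewrite (sum_triangle _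
  (fun k l => s (l - k)%N * \sum_(E (k + l)%N <= m < E (k + l).+2%N) t m)).
transitivity (\sum_(1 <= a < N) s a * (F (N - a + N)%N - F a)).
  apply: eq_big_nat => a /andP[a1 aN].
  have -> : F (N - a + N)%N - F a =
      \sum_(0 <= k < N - a) (F (k + (k + a)).+2%N - F (k + (k + a))%N).
    rewrite (telescope_sumr_eq (fun k => F (a + k.*2)%N))//; last first.
      by move=> k _; congr (F _ - F _); lia.
    by congr (F _ - F _); lia.
  by rewrite mulr_sumr; apply: eq_bigr => k _; rewrite addKn FB//; lia.
(* The first summand is the claimed product; the terms [s a * (e * F (N - a) - F a)] must add up to
   zero. *)
under eq_bigr do rewrite FN -addrA mulrDr.
rewrite big_split/= -mulr_suml [X in _ + X](_ : _ = 0) ?addr0//.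
under eq_bigr do rewrite mulrBr.
rewrite sumrB; apply/eqP; rewrite subr_eq0; apply/eqP.
rewrite [LHS]big_nat_rev/=; apply: eq_big_nat => a /andP[a1 aN].
rewrite add1n subSS [in RHS]sN ?a1//.
by rewrite mulrA [e * _]mulrC subKn// ltnW.
Qed.

(** * Signs of sines and sums of the wave over a period *)

Section Trigonometry.
Context {R : realType}.
Implicit Types (x y : R) (m n : nat).

Lemma sinDnpi x n : sin (x + n%:R * pi) = (-1) ^+ n * sin x.
Proof. by rewrite mulr_natl (alternatingn (@sinDpi R)). Qed.

Lemma cosDnpi x n : cos (x + n%:R * pi) = (-1) ^+ n * cos x.
Proof. by rewrite mulr_natl (alternatingn (@cosDpi R)). Qed.

Lemma sin_sum_diff x y : sin (x + y) - sin (x - y) = 2 * cos x * sin y.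
Proof. rewrite sinD sinB; ring. Qed.

Lemma cos_sum_diff x y : cos (x + y) - cos (x - y) = - 2 * sin x * sin y.
Proof. rewrite cosD cosB; ring. Qed.

Lemma cos_halfpi_odd m : cos (pi * (m%:R + 1 / 2) : R) = 0.
Proof.
have -> : pi * (m%:R + 1 / 2) = pi / 2 + m%:R * pi :> R by ring.
by rewrite cosDnpi cos_pihalf mulr0.
Qed.

Lemma sin_halfpi_odd m : sin (pi * (m%:R + 1 / 2) : R) = (-1) ^+ m.
Proof.
have -> : pi * (m%:R + 1 / 2) = pi / 2 + m%:R * pi :> R by ring.
by rewrite sinDnpi sin_pihalf mulr1.
Qed.

Lemma cos_pos_eq0 x : 0 < x -> cos x = 0 -> exists m, x = pi * (m%:R + 1 / 2).
Proof.
move=> x0 cx0; have pi0 := pi_gt0 R.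
have xpi : 0 <= x / pi by rewrite divr_ge0 ?ltW.
have /andP[mx xm] := truncn_itv xpi; set m := Num.truncn _ in mx xm.
move: mx xm; rewrite ler_pdivlMr// ltr_pdivrMr// -natr1 => mx xm.
(* Removing [m] half-turns brings the angle into [[0, pi)], where the cosine is injective. *)
exists m; have xE : x = x - m%:R * pi + m%:R * pi by rewrite subrK.
have : cos (x - m%:R * pi) = cos (pi / 2).
  move: cx0; rewrite {1}xE cosDnpi cos_pihalf => /eqP.
  by rewrite mulf_eq0 signr_eq0/= => /eqP.
move/cos_inj; rewrite !in_itv/= => /(_ _ _)H.
have {}H : x - m%:R * pi = pi / 2 by apply: H; lra.
by rewrite xE H; ring.
Qed.

Lemma sgz_sign n : sgz ((-1) ^+ n : R) = (-1) ^+ n.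
Proof. by rewrite sgzX sgzN sgz1. Qed.

(** Each multiple of [n] in [a] is a half-turn and flips the sign; the nonzero remainder gives an
    angle strictly between 0 and [pi]. *)
Lemma sgz_sin_ratio (n a : nat) : (0 < n)%N -> ~~ (n %| a)%N ->
  sgz (sin (pi * a%:R / n%:R : R)) = (-1) ^+ (a %/ n)%N.
Proof.
move=> n0 na; have n0R : 0 < n%:R :> R by rewrite ltr0n.
have -> : pi * a%:R / n%:R = pi * (a %% n)%:R / n%:R + (a %/ n)%:R * pi :> R.
  by rewrite {1}(divn_eq a n) natrD natrM; field; rewrite gt_eqF.
rewrite sinDnpi sgzM sgz_sign gtr0_sgz ?mulr1//; apply: sin_gt0_pi.
have pi0 := pi_gt0 R.
apply/andP; split; first by rewrite divr_gt0 ?mulr_gt0// ltr0n lt0n.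
by rewrite ltr_pdivrMr// ltr_pM2l// ltr_nat ltn_pmod.
Qed.

(** The factor w(m) of the crossing sign, with delta the phase of the braid. *)
Definition wave (delta : R) (p q m : nat) : int :=
  (-1) ^+ m * sgz (sin (delta + pi * (p * m.*2.+1)%:R / q.*2%:R)).

(** The relation [p n = c q] says that shifting by [n] turns the angle by exactly [c] half-turns;
    the alternating factor supplies the other [n] signs. *)
Lemma wave_shift (delta : R) (p q n c m : nat) : (0 < q)%N ->
  (p * n = c * q)%N ->
  wave delta p q (m + n) = (-1) ^+ (n + c) * wave delta p q m.
Proof.
move=> q0 pn; rewrite /wave.
have -> : (p * (m + n).*2.+1 = p * m.*2.+1 + c * q.*2)%N.
  by rewrite doubleD -addSn mulnDr -!doubleMr pn.
have q2 : q.*2%:R != 0 :> R by rewrite pnatr_eq0 double_eq0 -lt0n.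
have -> : delta + pi * (p * m.*2.+1 + c * q.*2)%:R / q.*2%:R =
    delta + pi * (p * m.*2.+1)%:R / q.*2%:R + c%:R * pi.
  by rewrite natrD (natrM _ c); field.
by rewrite sinDnpi sgzM sgz_sign !exprD; ring.
Qed.

(** For odd [p], [p (2m + 1)] is the odd number of index [p m + (p - 1) / 2], and
    [(-1) ^ (p m) = (-1) ^ m]. This trades the frequency [p] for an affine substitution. *)
Lemma wave_odd (delta : R) (p q m : nat) : odd p ->
  wave delta p q m = (-1) ^+ p./2 * wave delta 1 q (p * m + p./2).
Proof.
move=> op; rewrite /wave mul1n.
have -> : (p * m.*2.+1 = (p * m + p./2).*2.+1)%N.
  rewrite mulnS -doubleMr doubleD; move: (p * m)%N => pm.
  by have := odd_double_half p; rewrite op; lia.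
rewrite exprD [_ ^+ (p * m) * _]mulrC !mulrA -expr2 sqrr_sign mul1r.
by rewrite -[in RHS]signr_odd oddM op signr_odd.
Qed.

Lemma wave_scale (delta : R) (p q d m : nat) : (0 < d)%N ->
  wave delta (d * p) (d * q) m = wave delta p q m.
Proof.
move=> d0; rewrite /wave -mulnA doubleMr !(natrM _ d).
have d0R : d%:R != 0 :> R by rewrite pnatr_eq0 -lt0n.
by rewrite mulrCA -mulf_div divff// mul1r.
Qed.

Lemma wave_period (delta : R) (p q m : nat) :
  odd p -> odd q -> wave delta p q (m + q) = wave delta p q m.
Proof.
move=> op oq; rewrite (@wave_shift _ _ _ _ p) ?odd_gt0// -signr_odd oddD op oq.
by rewrite expr0 mul1r.
Qed.

Lemma wave_mod (delta : R) (p q m : nat) :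
  odd p -> odd q -> wave delta p q (m %% q) = wave delta p q m.
Proof.
move=> op oq; rewrite {2}(divn_eq m q) addnC.
by elim: (m %/ q)%N => [|k IHk]; rewrite ?addn0// mulSnr addnA wave_period.
Qed.

Lemma coprime_affine_inj (p q r : nat) : (0 < q)%N -> coprime q p ->
  {in [pred m | m < q]%N &, injective (fun m => (p * m + r) %% q)%N}.
Proof.
move=> q0 cqp a b; rewrite !inE => aq bq /eqP.
rewrite eqn_modDr.
wlog ab : a b aq bq / (b <= a)%N.
  move=> H e; case/orP: (leq_total a b) => ?; last exact: H.
  by apply/esym/H => //; rewrite eq_sym.
rewrite eqn_mod_dvd ?leq_mul2l ?ab ?orbT// -mulnBr Gauss_dvdr// => dv.
apply/eqP; rewrite eqn_leq ab andbT -subn_eq0.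
by apply: contraTT dv => nz; rewrite gtnNdvd ?lt0n// (leq_ltn_trans (leq_subr _ _)).
Qed.

(** The angle advances by [pi / q], so a suitable window of [q] indices stays in a half-turn of
    constant sine sign. There the terms alternate, and an odd number of them collapses to one
    sign. *)
Lemma sum_wave_window (delta : R) (q : nat) : odd q ->
  (forall j, wave delta 1 q j != 0) ->
  exists c, \sum_(0 <= j < q) wave delta 1 q j = (-1) ^+ c.
Proof.
move=> oq nz; have q0 := odd_gt0 oq; have pi0 := pi_gt0 R.
have q0R : 0 < q.*2%:R :> R by rewrite ltr0n double_gt0.
pose th j : R := delta + pi * (j.*2.+1)%:R / q.*2%:R.
have thD a b : th (a + b)%N = th a + b%:R * (pi * 2 / q.*2%:R).
  by rewrite /th doubleD -addSn natrD -[b.*2]muln2 natrM; ring.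
(* Enough full turns to pass the initial angle, whatever the sign of [delta], so that the window
   starts at a natural index. *)
pose z := (Num.truncn (th 0%N / (pi *+ 2))).+1.
have z_gt : th 0%N < pi *+ 2 *+ z.
  have p2 : 0 < pi *+ 2 :> R by rewrite pmulrn_lgt0.
  by have := truncnS_gt (th 0%N / (pi *+ 2)); rewrite ltr_pdivrMr// mulr_natl.
have st0 : 0 < pi * 2 / q.*2%:R :> R by rewrite divr_gt0 ?mulr_gt0.
have y0 : 0 <= (pi *+ 2 *+ z - th 0%N) / (pi * 2 / q.*2%:R).
  by apply: divr_ge0; rewrite ?subr_ge0 ltW.
have /andP[] := truncn_itv y0; set n := Num.truncn _.
(* Thus [n] is the last index with [th n <= 2 pi z], and the window opens at [n.+1]. *)
rewrite ler_pdivlMr// ltr_pdivrMr// -(natr1 n) => nle ltn.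
exists n.+1; rewrite -(@sum_window _ _ _ n.+1); last by move=> m; exact: wave_period.
(* On the window starting at [n.+1] the angles lie in a half-turn where the
   sine is nonnegative, modulo [2 pi]. *)
transitivity (\sum_(0 <= i < q) (-1) ^+ (n.+1 + i) : int).
  apply: eq_big_nat => i /andP[_ iq]; have := nz (n.+1 + i)%N.
  rewrite /wave mul1n -/(th _); set s := sin _ => nz_s.
  have s_ge0 : 0 <= s.
    rewrite /s -[th _](subrK (pi *+ 2 *+ z)) (periodicn (@sinD2pi R)).
    apply: sin_ge0_pi; rewrite -{1 2}[n.+1]add0n -addnA thD natrD -(natr1 n).
    have iqR : (i%:R + 1) * (pi * 2 / q.*2%:R) <= pi :> R.
      have qpi : q%:R * (pi * 2 / q.*2%:R) = pi :> R.
        by rewrite -muln2 natrM; field; rewrite pnatr_eq0 -lt0n.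
      by rewrite -[leRHS]qpi ler_wpM2r ?(ltW st0)// natr1 ler_nat.
    have iX_ge0 : 0 <= i%:R * (pi * 2 / q.*2%:R) :> R by rewrite mulr_ge0// ltW.
    move: nle ltn iqR iX_ge0; move: (pi * 2 / _) (pi *+ 2 *+ z) => X P *.
    by apply/andP; split; lra.
  (* The last angle may reach [pi] in these bounds; only the nonvanishing of the wave makes the sine
     positive. *)
  rewrite gtr0_sgz ?mulr1// lt_def s_ge0 andbT.
  by apply: contraNneq nz_s => ->; rewrite sgz0 mulr0.
under eq_bigr do rewrite exprD.
rewrite -mulr_sumr -[RHS]mulr1; congr (_ * _).
have -> : q = q./2.*2.+1 by rewrite -[LHS]odd_double_half oq.
elim: (q./2) => [|k IHk]; first by rewrite big_nat1.
rewrite doubleS big_nat_recr//= big_nat_recr//= IHk.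
by rewrite !exprS -mul2n exprM sqrrN !expr1n.
Qed.

(** Since [p] is invertible modulo [q], the substitution of [wave_odd] permutes the residues and
    reduces the sum to frequency one. *)
Lemma sum_wave_odd (delta : R) (p q : nat) : odd p -> odd q -> coprime p q ->
  (forall m, wave delta p q m != 0) ->
  exists c, \sum_(0 <= m < q) wave delta p q m = (-1) ^+ c.
Proof.
move=> op oq cpq nz; have q0 := odd_gt0 oq.
pose f (i : 'I_q) := Ordinal (ltn_pmod (p * i + p./2) q0).
have f_inj : injective f.
  move=> i j /(congr1 val)/= /coprime_affine_inj ij; apply/val_inj/ij => //.
  - by rewrite coprime_sym.
  - by rewrite inE ltn_ord.
  - by rewrite inE ltn_ord.
have fE (i : 'I_q) : wave delta p q i = (-1) ^+ p./2 * wave delta 1 q (f i).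
  by rewrite wave_odd//= wave_mod.
have [|c sum_c] := sum_wave_window oq (delta := delta).
  (* [f] is onto, so nonvanishing along [p * m + p./2] gives it everywhere. *)
  move=> j; rewrite -wave_mod//.
  have -> : (j %% q = f (invF f_inj (Ordinal (ltn_pmod j q0))))%N by rewrite f_invF.
  have := nz (invF f_inj (Ordinal (ltn_pmod j q0))).
  by rewrite fE mulf_eq0 negb_or => /andP[].
exists (p./2 + c)%N; rewrite exprD -sum_c !big_mkord mulr_sumr [RHS](reindex_inj f_inj).
by apply: eq_bigr => i _; rewrite fE.
Qed.

End Trigonometry.

(** * Crossing times and crossing signs *)

Section Crossings.
Context {R : realType}.
Implicit Types (N p q k l m : nat) (eps eta t : R).

Lemma natr_odd m : m.*2.+1%:R = 2 * m%:R + 1 :> R.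
Proof. by rewrite -natr1 -muln2 natrM mulrC. Qed.

Definition phase N p eps : R := 2 * pi / N%:R * (p%:R * eps).

(** The solution of [q (2t + j) / N = m + 1/2], a zero of the cosine factor in [strand_xB] when
    [j = k + l]. *)
Definition crossing_time N q m j : R :=
  N%:R * m.*2.+1%:R / (4 * q%:R) - j%:R / 2.

(** For [0 < s < N] and [p], [q] coprime to [N], this is the sign of
    [sin (pi p s / N) * sin (pi q s / N)]. *)
Definition index_sign N p q s : int :=
  (-1) ^+ ((p * s) %/ N)%N * (-1) ^+ ((q * s) %/ N)%N.

Lemma coprime_ndvd_mul N p s : coprime N p -> (0 < s < N)%N -> ~~ (N %| p * s)%N.
Proof. by move=> cNp /andP[s0 sN]; rewrite Gauss_dvdr// gtnNdvd. Qed.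

(** The product form confines time to the cosine factor; the sine factor sees only [l - k]. *)
Lemma strand_xB N q k l t : (0 < N)%N -> (k <= l)%N ->
  strand_x N q k t - strand_x N q l t =
  - 2 * cos (pi * (q%:R * (2 * t + (k + l)%:R)) / N%:R)
      * sin (pi * (q * (l - k))%:R / N%:R).
Proof.
move=> N0 kl; have NR : N%:R != 0 :> R by rewrite pnatr_eq0 -lt0n.
rewrite /strand_x natrM natrB// natrD.
set u := pi * _ / _; set v := pi * _ / _.
rewrite (_ : 2 * pi / _ * _ = u - v); last by rewrite /u /v; field; exact: NR.
rewrite (_ : 2 * pi / _ * _ = u + v); last by rewrite /u /v; field; exact: NR.
by rewrite -opprB sin_sum_diff !mulNr.
Qed.

Lemma strand_yB N p eps k l t : (0 < N)%N -> (k <= l)%N ->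
  strand_y N p eps k t - strand_y N p eps l t =
  2 * sin (pi * (p%:R * (2 * t + (k + l)%:R + 2 * eps)) / N%:R)
    * sin (pi * (p * (l - k))%:R / N%:R).
Proof.
move=> N0 kl; have NR : N%:R != 0 :> R by rewrite pnatr_eq0 -lt0n.
rewrite /strand_y natrM natrB// natrD.
set u := pi * _ / _; set v := pi * _ / _.
rewrite (_ : 2 * pi / _ * _ = u - v); last by rewrite /u /v; field; exact: NR.
rewrite (_ : 2 * pi / _ * _ = u + v); last by rewrite /u /v; field; exact: NR.
by rewrite -opprB cos_sum_diff !mulNr opprK.
Qed.

Lemma derive1_strand_x N q k t :
  derive1 (strand_x N q k) t =
  2 * pi / N%:R * q%:R * cos (2 * pi / N%:R * (q%:R * (t + k%:R))).
Proof.
rewrite /strand_x derive1E.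
set c := 2 * pi / N%:R.
have dl : is_derive t 1 (fun t : R => c * (q%:R * (t + k%:R))) (c * q%:R).
  by apply: is_derive_eq; rewrite addr0 /GRing.scale/= mulr1.
have /@derive_val := is_derive1_comp (is_derive_sin _) dl.
by rewrite mulrC => <-.
Qed.

Lemma derive1_strand_xB N q k l t : (0 < N)%N -> (k <= l)%N ->
  derive1 (strand_x N q k) t - derive1 (strand_x N q l) t =
  2 * pi / N%:R * q%:R *
  (2 * sin (pi * (q%:R * (2 * t + (k + l)%:R)) / N%:R)
     * sin (pi * (q * (l - k))%:R / N%:R)).
Proof.
move=> N0 kl; have NR : N%:R != 0 :> R by rewrite pnatr_eq0 -lt0n.
rewrite !derive1_strand_x natrM natrB// natrD -mulrBr; congr (_ * _).
set u := pi * _ / _; set v := pi * _ / _.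
rewrite (_ : 2 * pi / _ * _ = u - v); last by rewrite /u /v; field; exact: NR.
rewrite (_ : 2 * pi / _ * _ = u + v); last by rewrite /u /v; field; exact: NR.
by rewrite -opprB cos_sum_diff !mulNr opprK.
Qed.

(** Coprimality keeps the sine factor of [strand_xB] nonzero, so only the cosine can vanish.
    Positivity of [t] makes its argument positive, hence [m] natural. *)
Lemma strand_x_eqP N q k l t : (0 < q)%N -> coprime N q -> (k < l < N)%N ->
  0 < t -> strand_x N q k t = strand_x N q l t <->
  exists m, t = crossing_time N q m (k + l).
Proof.
move=> q0 cNq /andP[kl lN] t0; have N0 : (0 < N)%N by lia.
have NR : N%:R != 0 :> R by rewrite pnatr_eq0 -lt0n.
have qR : q%:R != 0 :> R by rewrite pnatr_eq0 -lt0n.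
have sin0 : sin (pi * (q * (l - k))%:R / N%:R : R) != 0.
  rewrite -sgz_eq0 sgz_sin_ratio ?signr_eq0// coprime_ndvd_mul//; lia.
split=> [/eqP|[m tE]]; last first.
  apply/eqP; rewrite -subr_eq0 strand_xB// 1?ltnW//.
  rewrite [X in cos X](_ : _ = pi * (m%:R + 1 / 2)).
    by rewrite cos_halfpi_odd mulr0 mul0r.
  by rewrite tE /crossing_time natr_odd; field; rewrite NR qR.
rewrite -subr_eq0 strand_xB// 1?ltnW// !mulf_eq0 oppr_eq0 pnatr_eq0 (negbTE sin0) orbF/=.
move/eqP/cos_pos_eq0 => []; last first.
  move=> m; set c := pi * _ / _ => cE; exists m; rewrite /crossing_time natr_odd.
  have pi_neq0 : pi != 0 :> R by rewrite gt_eqF// pi_gt0.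
  have -> : t = c * N%:R / (2 * pi * q%:R) - (k + l)%:R / 2.
    by rewrite /c; move: pi pi_neq0 => P P0; field; apply/and3P.
  by rewrite cE; move: pi pi_neq0 => P P0; field; apply/andP.
rewrite divr_gt0 ?ltr0n// !mulr_gt0 ?pi_gt0 ?ltr0n//.
by rewrite ltr_wpDr// mulr_gt0.
Qed.

Lemma strand_yB_time N p q eps k l m : (0 < N)%N -> (0 < q)%N -> (k <= l)%N ->
  strand_y N p eps k (crossing_time N q m (k + l)) -
  strand_y N p eps l (crossing_time N q m (k + l)) =
  2 * sin (phase N p eps + pi * (p * m.*2.+1)%:R / q.*2%:R)
    * sin (pi * (p * (l - k))%:R / N%:R).
Proof.
move=> N0 q0 kl; rewrite strand_yB//; congr (2 * sin _ * _).
have NR : N%:R != 0 :> R by rewrite pnatr_eq0 -lt0n.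
have qR : q%:R != 0 :> R by rewrite pnatr_eq0 -lt0n.
rewrite /crossing_time /phase natrM natr_odd -[q.*2]muln2 !natrM.
by field; rewrite NR qR.
Qed.

(** At a crossing the velocity difference contributes [(-1) ^ m] and the sign of
    [sin (pi q (l - k) / N)]; the height difference contributes the two remaining sines. *)
Lemma crossing_sign_time N p q eps (k l : 'I_N) m :
  (0 < q)%N -> coprime N q -> coprime N p -> (k < l)%N ->
  crossing_sign p q eps (k, l, crossing_time N q m (k + l)) =
  index_sign N p q (l - k) * wave (phase N p eps) p q m.
Proof.
move=> q0 cNq cNp kl; have N0 : (0 < N)%N by case: k {kl} => ? /=; lia.
have ltlN := ltn_ord l.
have NR : N%:R != 0 :> R by rewrite pnatr_eq0 -lt0n.
have qR : q%:R != 0 :> R by rewrite pnatr_eq0 -lt0n.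
rewrite /crossing_sign derive1_strand_xB// 1?ltnW// strand_yB_time// 1?ltnW//.
rewrite [X in 2 * sin X](_ : _ = pi * (m%:R + 1 / 2)); last first.
  by rewrite /crossing_time natr_odd; field; rewrite NR qR.
rewrite sin_halfpi_odd.
rewrite !sgzM !sgz_sin_ratio ?coprime_ndvd_mul//; try lia.
rewrite sgz_sign gtr0_sgz ?ltr0n// (gtr0_sgz (pi_gt0 R)).
rewrite (gtr0_sgz (x := q%:R)) ?ltr0n//.
rewrite (gtr0_sgz (x := N%:R^-1)) ?invr_gt0 ?ltr0n// /index_sign /wave.
ring.
Qed.

End Crossings.

(** * Counting crossings in the time interval and symmetry of the index signs *)

Section Writhe.
Context {R : realType}.
Implicit Types (N p q j k m : nat) (eps eta : R).

(** The number of [m] such that [N (2m+1) / (4q) <= eta + j/2]. *)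
Definition level N q eta j : nat :=
  Num.truncn (2 * q%:R / N%:R * (eta + j%:R / 2) + 1 / 2).

Lemma rational_crossing_time N q m j : (0 < q)%N ->
  rational (crossing_time N q m j : R).
Proof.
move=> q0; have qR : q%:R != 0 :> R by rewrite pnatr_eq0 -lt0n.
apply/rationalP; exists ((N * m.*2.+1)%:Z - (q.*2 * j)%:Z), (4 * q)%N.
rewrite rmorphB/= -!pmulrn !natrM -[q.*2]muln2 natrM /crossing_time.
by field.
Qed.

Lemma crossing_time_inj N q j : (0 < N)%N -> (0 < q)%N ->
  injective (fun m => crossing_time N q m j : R).
Proof.
move=> N0 q0 a b /addIr/divIf; rewrite mulf_neq0 ?pnatr_eq0 -?lt0n// => /(_ isT).
move/mulfI; rewrite pnatr_eq0 -lt0n => /(_ N0)/eqP.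
by rewrite eqr_nat eqSS => /eqP/double_inj.
Qed.

Lemma crossing_time_itv N q eta m j : (0 < N)%N -> (0 < q)%N ->
  0 < eta -> irrational eta ->
  (eta <= crossing_time N q m j <= 1 + eta) =
  (level N q eta j <= m < level N q eta j.+2)%N.
Proof.
move=> N0 q0 eta0 irr.
have NR : 0 < N%:R :> R by rewrite ltr0n.
have qR : 0 < q%:R :> R by rewrite ltr0n.
have lt_level i : (m < level N q eta i)%N =
    (N%:R * m.*2.+1%:R / (4 * q%:R) <= eta + i%:R / 2).
  rewrite truncn_gt_nat natr_odd -(natr1 m) -lerBlDr.
  rewrite -ler_pdivrMl ?divr_gt0 ?mulr_gt0//.
  by congr (_ <= _); field; rewrite !gt_eqF.
(* [level] yields a strict lower bound. Equality would make [eta] a crossing time, hence rational.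
   At the upper end, adding 1 to the time amounts to adding 2 to [j]. *)
rewrite [in RHS]leqNgt !lt_level -ltNge /crossing_time; congr (_ && _).
  rewrite le_eqVlt ltrBrDr; case: eqP => [etaE|//].
  by case: irr; rewrite etaE; exact: rational_crossing_time.
by rewrite lerBlDr; congr (_ <= _); rewrite -addn2 natrD; field.
Qed.

Lemma level_homo N q eta : {homo level N q eta : a b / (a <= b)%N}.
Proof.
move=> a b ab; apply: le_truncn; rewrite lerD2r ler_wpM2l ?divr_ge0 ?mulr_ge0//.
by rewrite lerD2l ler_pM2r ?ler_nat// invr_gt0.
Qed.

Lemma levelD N q eta j : (0 < N)%N -> 0 < eta ->
  (level N q eta (j + N) = level N q eta j + q)%N.
Proof.
move=> N0 eta0; have NR : N%:R != 0 :> R by rewrite pnatr_eq0 -lt0n.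
rewrite /level.
have -> : 2 * q%:R / N%:R * (eta + (j + N)%:R / 2) + 1 / 2 =
    q%:R + (2 * q%:R / N%:R * (eta + j%:R / 2) + 1 / 2) by rewrite natrD; field.
rewrite truncnD ?natr_nat//; first by rewrite natrK addnC.
rewrite nnegrE; apply: addr_ge0; last by rewrite divr_ge0.
rewrite mulr_ge0 ?divr_ge0 ?mulr_ge0//; apply: addr_ge0; first exact: ltW.
by rewrite divr_ge0.
Qed.

Lemma exists_step (f : nat -> nat) n m : (f 0 <= m < f n)%N ->
  exists2 k, (k < n)%N & (f k <= m < f k.+1)%N.
Proof.
elim: n => [|n IHn]; first by case/andP=> /leq_ltn_trans h /h; rewrite ltnn.
move=> /andP[f0 fn]; case: (leqP (f n) m) => fnm; first by exists n; rewrite ?fnm.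
by have [|k kn fk] := IHn; [rewrite f0|exists k => //; exact: ltnW].
Qed.

Lemma writhe_sum N p q eps eta : (1 < N)%N -> (0 < q)%N ->
  coprime N p -> coprime N q -> 0 < eta -> irrational eta ->
  writhe N p q eps eta =
  \sum_(k < N) \sum_(l < N | (k < l)%N) index_sign N p q (l - k) *
     \sum_(level N q eta (k + l) <= m < level N q eta (k + l).+2)
        wave (phase N p eps) p q m.
Proof.
move=> N1 q0 cNp cNq eta0 irr; have N0 : (0 < N)%N by exact: ltnW.
(* As [k + l + 2 <= 2N], this bounds [m] uniformly, so crossings can be indexed by a finite type. *)
pose M := level N q eta (N + N).
pose P (x : 'I_N * 'I_N * 'I_M) :=
  (x.1.1 < x.1.2)%N && (level N q eta (x.1.1 + x.1.2) <= x.2 <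
                        level N q eta (x.1.1 + x.1.2).+2)%N.
pose h (x : 'I_N * 'I_N * 'I_M) : 'I_N * 'I_N * R :=
  (x.1, crossing_time N q x.2 (x.1.1 + x.1.2)).
rewrite /writhe (reindex_fsbig h [set` P]); last first.
  split.
  - move=> [[k l] m]; rewrite /P/= => /andP[kl ml]; split=> //.
      by rewrite crossing_time_itv.
    apply/strand_x_eqP => //; rewrite ?kl ?ltn_ord//; last by exists m.
    by apply: (lt_le_trans eta0); move: ml; rewrite -crossing_time_itv// => /andP[].
  - move=> [[k l] m] [[k' l'] m'] _ _ [<- <-] /crossing_time_inj mE.
    by congr (_, _); apply/val_inj/mE.
  - move=> [[k l] t] /= [kl tI xE].
    have t0 : 0 < t by case/andP: tI => etat _; exact: lt_le_trans etat.
    have [|m tE] := (strand_x_eqP q0 cNq _ t0).1 xE; first by rewrite kl ltn_ord.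
    have ml := tI; rewrite tE crossing_time_itv// in ml.
    have mM : (m < M)%N.
      case/andP: ml => _ /leq_trans; apply; apply: level_homo.
      by have := ltn_ord l; have := ltn_ord k; lia.
    exists (k, l, Ordinal mM); last by rewrite /h tE.
    by rewrite /= /in_mem/= /P/= kl.
rewrite -(@bigfs _ _ _ _ (index_enum _)) ?index_enum_uniq//; last first.
  by move=> x _; rewrite mem_index_enum.
rewrite pair_big_dep/=.
have widen (k l : 'I_N) : \sum_(level N q eta (k + l) <= m < level N q eta (k + l).+2)
    wave (phase N p eps) p q m =
  \sum_(m < M | (level N q eta (k + l) <= m < level N q eta (k + l).+2)%N)
     wave (phase N p eps) p q m.
  rewrite (big_nat_widenl _ 0)//= (big_nat_widen _ _ M); last first.
    by apply: level_homo; have := ltn_ord l; have := ltn_ord k; lia.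
  by rewrite big_mkord.
under [RHS]eq_bigr do rewrite widen mulr_sumr.
rewrite pair_big_dep/=; apply: eq_bigr => -[[k l] m] /andP[/= kl _].
exact: crossing_sign_time.
Qed.

Lemma wave_eq0_shift (delta : R) p q m c : (0 < q)%N ->
  (wave delta p q (m + c * q) == 0) = (wave delta p q m == 0).
Proof.
move=> q0; rewrite (@wave_shift _ _ _ _ _ (c * p)) ?mulf_eq0 ?signr_eq0//.
by rewrite mulnCA mulnA.
Qed.

(** The intervals defining the crossings of strands at distance 1 cover a full
    period of m, so that disjointness of the strands controls every [m]. *)
Lemma wave_neq0 N p q eps eta m : (1 < N)%N -> (0 < q)%N ->
  coprime N q -> 0 < eta -> irrational eta ->
  distinct_strands N p q eps eta -> wave (phase N p eps) p q m != 0.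
Proof.
move=> N1 q0 cNq eta0 irr dist; have N0 := ltnW N1.
(* Adding a multiple of [q] preserves vanishing and moves [m] beyond [E 1]; it is then reduced to
   the period starting at [E 1]. *)
pose E := level N q eta; pose m1 := (m + E 1 * q)%N.
have Em1 : (E 1 <= m1)%N by rewrite /m1; nia.
rewrite -(wave_eq0_shift _ _ _ (E 1) q0) -/m1.
have -> : m1 = (E 1 + (m1 - E 1) %% q + (m1 - E 1) %/ q * q)%N.
  by rewrite -addnA [(_ %% _ + _)%N]addnC -divn_eq subnKC.
rewrite wave_eq0_shift//.
(* Strands [k] and [k + 1] have index sum [2k + 1]. Their ranges run from [E 1] to [E (2N - 1)],
   which is at least [E (N + 1) = E 1 + q] because [N >= 2]. *)
have [|k kN /andP[mE Em]] := @exists_step (fun k => E k.*2.+1) N.-1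
    (E 1 + (m1 - E 1) %% q)%N.
  rewrite leq_addr/=; apply: (@leq_trans (E 1 + q)%N); first by rewrite ltn_add2l ltn_pmod.
  by rewrite -levelD//; apply: level_homo; lia.
set n := (_ + _)%N in mE Em *.
have kN1 : (k < N)%N by lia.
have kN2 : (k.+1 < N)%N by lia.
have jE : (k + k.+1 = k.*2.+1)%N by lia.
have tI : eta <= crossing_time N q n (k + k.+1) <= 1 + eta.
  by rewrite crossing_time_itv// jE mE.
have := dist _ tI (Ordinal kN1) (Ordinal kN2).
rewrite -val_eqE/= neq_ltn ltnSn => /(_ isT); apply: contra_neq => w0.
rewrite /strand; congr (_, _).
  apply/strand_x_eqP; rewrite ?ltnSn//; last by exists n.
  by apply: (lt_le_trans eta0); case/andP: tI.
apply/eqP; rewrite -subr_eq0 strand_yB_time//.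
by move/eqP: w0; rewrite /wave mulf_eq0 signr_eq0/= sgz_eq0 => /eqP->;
   rewrite mulr0 mul0r.
Qed.

(** The numbers [a s] and [a (N - s)] add up to [a N]; their remainders are nonzero and add up to
    [N], which costs the quotients one unit. *)
Lemma divn_refl (N a s : nat) : ~~ (N %| a * s)%N -> (s < N)%N ->
  ((a * s) %/ N + ((a * (N - s)) %/ N).+1 = a)%N.
Proof.
move=> nas sN; have N0 : (0 < N)%N by exact: leq_ltn_trans sN.
have a0 : (0 < a)%N by case: a nas => //; rewrite mul0n dvdn0.
have fa : (a * s %/ N < a)%N by rewrite ltn_divLR// ltn_pmul2l.
have r0 : (0 < a * s %% N)%N by rewrite lt0n.
have rN : (a * s %% N < N)%N by rewrite ltn_pmod.
have -> : (a * (N - s) = (a - (a * s %/ N).+1) * N + (N - a * s %% N))%N.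
  have := divn_eq (a * s) N; have := leq_mul fa (leqnn N).
  rewrite mulnBr mulnBl mulSn; lia.
by rewrite divnMDl// (@divn_small (N - _)) ?ltn_subrL ?r0//; lia.
Qed.

Lemma signr_divn_refl (N a s : nat) : coprime N a -> (0 < s < N)%N ->
  (-1) ^+ (a * s %/ N)%N = - ((-1) ^+ a * (-1) ^+ (a * (N - s) %/ N)%N) :> int.
Proof.
move=> cNa sN; have := divn_refl (coprime_ndvd_mul cNa sN) (proj2 (andP sN)).
move: (_ %/ _)%N (_ %/ _)%N => f g <-.
by rewrite exprD exprS mulN1r mulrN mulNr opprK -mulrA -expr2 sqrr_sign mulr1.
Qed.

Lemma index_sign_sym N p q s : coprime N p -> coprime N q -> (0 < s < N)%N ->
  index_sign N p q s = (-1) ^+ (p + q) * index_sign N p q (N - s).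
Proof.
move=> cNp cNq sN; rewrite /index_sign (signr_divn_refl cNp sN).
by rewrite (signr_divn_refl cNq sN) exprD; ring.
Qed.

End Writhe.

(** * Factorization of the writhe and the parity cases *)

Theorem proposition1 (R : realType) (N p q : nat) (eps eta : R)
  (hN : (2 <= N)%N) (hp : (N < p)%N) (hq : (N < q)%N)
  (hNp : coprime N p) (hNq : coprime N q)
  (heta : 0 < eta) (heta_irr : irrational eta)
  (hdist : distinct_strands N p q eps eta) :
  let d := gcdn p q in
  let p' := (p %/ d)%N in
  let q' := (q %/ d)%N in
  let rhs : int := d%:Z * \sum_(1 <= s < N)
      ((-1) ^+ ((p * s) %/ N)%N * (-1) ^+ ((q * s) %/ N)%N) in
  (odd p' <> odd q' -> writhe N p q eps eta = 0) /\
  (odd p' = odd q' ->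
     writhe N p q eps eta = rhs \/ writhe N p q eps eta = - rhs).
Proof.
move=> d p' q'; have q0 : (0 < q)%N by exact: leq_ltn_trans hq.
have N0 : (0 < N)%N by exact: ltnW.
have d0 : (0 < d)%N by rewrite gcdn_gt0 q0 orbT.
have pE : p = (d * p')%N by rewrite mulnC divnK// dvdn_gcdl.
have qE : q = (d * q')%N by rewrite mulnC divnK// dvdn_gcdr.
have cpq' : coprime p' q'.
  by rewrite /coprime -(eqn_pmul2l d0) muln_gcdr -pE -qE muln1.
pose S : int := \sum_(1 <= s < N) index_sign N p q s.
pose w := wave (phase N p eps) p q.
have S_sym : S = (-1) ^+ (p + q) * S.
  rewrite {1}/S big_nat_rev/= mulr_sumr; apply: eq_big_nat => s sN.
  rewrite add1n subSS index_sign_sym// ?subKn//; first by case/andP: sN => _ /ltnW.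
  by move: sN; lia.
have writheE : writhe N p q eps eta = S * \sum_(0 <= m < q) w m.
  rewrite writhe_sum//; apply: (@sum_telescope_arcs _ _ _ ((-1) ^+ (p + q))).
  - exact: level_homo.
  - by move=> j; exact: levelD.
  - by move=> m; rewrite /w (@wave_shift _ _ _ _ _ p)// addnC.
  - by move=> s sN; exact: index_sign_sym.
(* Since [p q' = p' q], the shorter shift [q'] is already a quasi-period. *)
have w_shift m : w (m + q')%N = (-1) ^+ (q' + p') * w m.
  by rewrite /w (@wave_shift _ _ _ _ _ p')// [in LHS]pE [in RHS]qE mulnA [(p' * d)%N]mulnC.
rewrite writheE [in \sum_(0 <= m < q) _]qE (sum_quasi_periodic _ w_shift).
split=> [ne_odd|eq_odd].
  have odd_sum : odd (q' + p') by rewrite oddD; case: (odd p') (odd q') ne_odd => [] [].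
  (* For odd [d], [p + q] is odd and [S_sym] forces [S = 0]. For even [d], the [d] blocks of length
     [q'] have alternating signs and cancel in pairs. *)
  have [od|ed] := boolP (odd d).
    suff -> : S = 0 by rewrite mul0r.
    move: S_sym; rewrite -signr_odd pE qE oddD !oddM od/= -oddD addnC odd_sum mulN1r.
    lia.
  suff -> : \sum_(0 <= i < d) ((-1) ^+ (q' + p')) ^+ i = 0 :> int by rewrite mul0r mulr0.
  rewrite -signr_odd odd_sum expr1 -[d]odd_double_half (negbTE ed) add0n.
  elim: d./2 => [|k IHk]; first by rewrite big_geq.
  by rewrite doubleS big_nat_recr//= big_nat_recr//= IHk exprS add0r mulN1r subrr.
(* Coprimality excludes that both are even. *)
have [op oq] : odd p' /\ odd q'.
  suff : odd p' || odd q' by rewrite eq_odd orbb.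
  apply: contraLR cpq'; rewrite negb_or => /andP[ep eq'].
  have : (2 %| gcdn p' q')%N by rewrite dvdn_gcd !dvdn2 ep.
  by apply: contraL => /eqP->.
have even_sum : ~~ odd (q' + p') by rewrite oddD op oq.
rewrite -signr_odd (negbTE even_sum) expr0.
under eq_bigr do rewrite expr1n.
rewrite sumr_const_nat subn0.
have [|c cE] := sum_wave_odd (delta := phase N p eps) op oq cpq'.
  (* The wave depends only on the ratio of [p] to [q], so nonvanishing passes to the reduced
     pair. *)
  move=> m; rewrite -(wave_scale _ _ _ _ d0) -pE -qE.
  exact: wave_neq0 heta heta_irr hdist.
have -> : \sum_(0 <= m < q') w m = (-1) ^+ c.
  rewrite -cE; apply: eq_bigr => m _.
  by rewrite -(wave_scale _ _ _ _ d0) -pE -qE.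
rewrite /S /index_sign -signr_odd pmulrn.
by case: (odd c); [right|left]; rewrite ?expr0 ?expr1; ring.
Qed.
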